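(* Let $m,n,p,q,r$ be positive integers with $p\le m$ and $q\le n$. Suppose the tensor $\mathcal{A}\in\mathbb{R}^{m\times n\times r}$ has (tensor) singular values $$\alpha_1\ge\alpha_2\ge\cdots\ge\alpha_{n'}\ge 0,\qquad n'=\min\{m,n\},$$ and suppose $\mathcal{B}\in\mathbb{R}^{p\times q\times r}$ is a subtensor of $\mathcal{A}$ with (tensor) singular values $$\beta_1\ge\beta_2\ge\cdots\ge\beta_{p'}\ge 0,\qquad p'=\min\{p,q\}.$$ Then $$\alpha_j\ge\beta_j,\qquad j=1,2,\dots,p',$$ $$\beta_j\ge\alpha_{j+(m-p)+(n-q)},\qquad j=1,2,\dots,\min\{p+q-m,\;p+q-n\}.$$
   Context: For a third-order tensor $\mathcal{A}\in\mathbb{R}^{m\times n\times r}$, let $A_k=\mathcal{A}(:,:,k)\in\mathbb{R}^{m\times n}$, $k=1,\dots,r$, be its frontal slices. Let $\hat{\mathcal{A}}\in\mathbb{C}^{m\times n\times r}$ be the tensor obtained by applying the discrete Fourier transform along the third mode, i.e. its frontal slices are $\hat A_k=\sum_{j=1}^{r}\omega^{(k-1)(j-1)}A_j$ with $\omega=e^{-2\pi \mathtt{i}/r}$. Tensor singular values: $\mathcal{A}$ has a T-SVD $\mathcal{A}=\mathcal{U}*\mathcal{S}*\mathcal{V}^{\mathrm T}$ (with respect to the T-product $*$, with $\mathcal{U},\mathcal{V}$ orthogonal tensors and $\mathcal{S}$ having diagonal frontal slices) in which the diagonal of the $k$-th Fourier-transformed frontal slice $\hat{S}_k$ of $\mathcal{S}$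 consists of the singular values of the matrix $\hat A_k$ in decreasing order. The singular values of $\mathcal{A}$ are the diagonal entries of the first frontal slice $\mathcal{S}(:,:,1)$. Equivalently, if $\sigma_1(\hat A_k)\ge\cdots\ge\sigma_{\min\{m,n\}}(\hat A_k)\ge 0$ are the ordinary singular values of $\hat A_k$, the $i$-th singular value of $\mathcal{A}$ is $$\sigma_i(\mathcal{A})=\frac1r\sum_{k=1}^{r}\sigma_i(\hat A_k),\qquad i=1,\dots,\min\{m,n\}.$$ Subtensor: $\mathcal{B}\in\mathbb{R}^{p\times q\times r}$ is a subtensor of $\mathcal{A}\in\mathbb{R}^{m\times n\times r}$ if it is obtained from $\mathcal{A}$ by deleting $m-p$ horizontal slices $\mathcal{A}(i,:,:)$ and $n-q$ lateral slices $\mathcal{A}(:,j,:)$ (all $r$ frontal indices are kept). If the index range of an inequality is empty, that inequality asserts nothing. *)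

(* Defs.v *)
From mathcomp Require Import all_boot all_order all_algebra.
From mathcomp Require Import complex.
From mathcomp Require Import reals trigo.

Set Implicit Arguments.
Unset Strict Implicit.
Unset Printing Implicit Defensive.

Import Order.TTheory GRing.Theory Num.Theory.
Local Open Scope ring_scope.
Local Open Scope complex_scope.
Local Open Scope sesquilinear_scope.

(* Third-order tensors, given by their frontal slices A(:,:,k), k : 'I_r. *)
Definition tensor (T : Type) (m n r : nat) : Type := 'I_r -> 'M[T]_(m, n).

(* exp (- 2 i pi / r) *)
Definition dft_root (R : realType) (r : nat) : R[i] :=
  cos (2 * pi / r%:R) -i* sin (2 * pi / r%:R).

(* Discrete Fourier transform along the third mode; as slices are numbered
   from 0, the exponent (k-1)(j-1) of the usual formula becomes k * j. *)
Definition dft (R : realType) (m n r : nat) (A : tensor R m n r) :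
    tensor R[i] m n r :=
  fun k => \sum_(j < r) dft_root R r ^+ (k * j) *: map_mx (real_complex R) (A j).

(* The singular values of M, in decreasing order: square roots of the
   eigenvalues (with multiplicity) of the Hermitian matrix M^* M, which are
   nonnegative reals.  The list has length n; when m < n its last n - m entries
   are zeros, so its first minn m n entries are the usual singular values. *)
Definition singular_values (R : realType) (m n : nat) (M : 'M[R[i]]_(m, n)) :
    seq R :=
  sort >=%R [seq Num.sqrt (complex.Re (spectral_diag (M ^t* *m M) 0 j))
            | j <- enum 'I_n].

(* Numbered from 0: [singular_value M 0] is the largest one. *)
Definition singular_value (R : realType) (m n : nat) (M : 'M[R[i]]_(m, n))
    (i : nat) : R :=
  (singular_values M)`_i.

(* S(i,i,1), where A = U * S * V^T is a T-SVD: the first frontal slice of S is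
   the mean of its Fourier slices, whose diagonals hold the singular values of
   the Fourier slices of A.  Also numbered from 0, and meaningful for
   i < minn m n. *)
Definition tensor_singular_value (R : realType) (m n r : nat)
    (A : tensor R m n r) (i : nat) : R :=
  r%:R^-1 * \sum_(k < r) singular_value (dft A k) i.

(* B keeps the horizontal slices of A with indices f 0 < f 1 < ..., and the
   lateral slices with indices g 0 < g 1 < .... *)
Definition subtensor (T : Type) (m n p q r : nat)
    (B : tensor T p q r) (A : tensor T m n r) : Prop :=
  exists (f : 'I_p -> 'I_m) (g : 'I_q -> 'I_n),
    [/\ {homo f : i j / (i < j)%N}, {homo g : i j / (i < j)%N}
      & forall k, B k = mxsub f g (A k)].

(* Main.v *)
Require Import Defs.
From mathcomp Require Import all_boot all_order all_algebra.
From mathcomp Require Import complex.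
From mathcomp Require Import reals.

(** The discrete Fourier transform acts along the third mode only, so it commutes
    with the deletion of horizontal and lateral slices: each Fourier slice of B
    is the submatrix [mxsub f g M] of the corresponding Fourier slice M of A.
    A tensor singular value is the mean of the singular values of the Fourier
    slices, so both inequalities follow, slice by slice, from the interlacing of
    the singular values of a complex matrix and of its submatrices
    ([singular_value_mxsub_le] and [singular_value_le_mxsub]).

    Interlacing is proved in counting form.  For t >= 0, the i-th singular value
    of M (from 0) is at least t exactly when more than i eigenvalues of M^* M
    are at least t^2 ([le_singular_value]).  This number of eigenvalues has a
    variational description, a form of the Courant-Fischer theorem: it is the
    largest dimension of a space of row vectors u satisfying
    t^2 |u|^2 <= |u M^*|^2 ([stretched_subspace], [rank_stretched]).

    Such spaces can be moved between M and N = mxsub f g M.  Padding with zeros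
    sends a space that works for N to one that works for M, because N^* is
    obtained from M^* by restricting the input and dropping output coordinates,
    which can only decrease |u M^*|; hence N has at most as many large
    eigenvalues as M.  Conversely, in a space that works for M, the vectors u
    such that u vanishes on the n - q deleted columns and u M^* vanishes on the
    m - p deleted rows form a subspace of codimension at most
    (m - p) + (n - q).  Nothing is lost on it by passing to N, which bounds the
    number of large eigenvalues of M by that of N plus (m - p) + (n - q). *)

Import Order.TTheory GRing.Theory Num.Theory.
Local Open Scope ring_scope.
Local Open Scope complex_scope.
Local Open Scope sesquilinear_scope.

(** * Norms, unitary matrices and selection of coordinates *)

Definition sqnorm {C : numClosedFieldType} {n : nat} (u : 'rV[C]_n) : C :=
  \sum_j `|u 0 j| ^+ 2.

Lemma sqnormE (C : numClosedFieldType) n (u : 'rV[C]_n) :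
  sqnorm u = (u *m u^t*) 0 0.
Proof. by rewrite mxE; apply: eq_bigr => j _; rewrite !mxE normCK. Qed.

Lemma sqnorm_unitary (C : numClosedFieldType) m n (P : 'M[C]_(m, n))
    (u : 'rV[C]_m) : P \is unitarymx -> sqnorm (u *m P) = sqnorm u.
Proof.
by move=> Pu; rewrite !sqnormE trmx_mul map_mxM mulmxA mulmxtVK.
Qed.

(** Unitarity of a rectangular matrix means that its rows are orthonormal, and
    this is inherited by any family of distinct rows. *)
Lemma rowsub_unitarymx (C : numClosedFieldType) k m n (P : 'M[C]_(m, n))
    (f : 'I_k -> 'I_m) :
  injective f -> P \is unitarymx -> rowsub f P \is unitarymx.
Proof.
move=> f_inj /row_unitarymxP Pu; apply/row_unitarymxP => i j.
by rewrite !row_rowsub Pu (inj_eq f_inj).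
Qed.

Lemma unitarymx1 (C : numClosedFieldType) n : (1%:M : 'M[C]_n) \is unitarymx.
Proof. by apply/unitarymxP; rewrite trmx1 map_mx1 mulmx1. Qed.

Lemma card_predC_codom p m (f : 'I_p -> 'I_m) :
  injective f -> #|[predC codom f]| = (m - p)%N.
Proof.
move=> f_inj; have := cardC (mem (codom f)).
by rewrite card_codom // !card_ord => /(congr1 (subn^~ p)); rewrite addKn.
Qed.

Lemma sqnorm_colsub (C : numClosedFieldType) p m (f : 'I_p -> 'I_m)
    (u : 'rV[C]_m) :
  injective f -> sqnorm (colsub f u) = \sum_(j in codom f) `|u 0 j| ^+ 2.
Proof.
move=> /injectiveP f_inj; rewrite -big_uniq //= big_image.
by apply: eq_bigr => j _; rewrite mxE.
Qed.

Lemma sqnorm_colsub_le (C : numClosedFieldType) p m (f : 'I_p -> 'I_m)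
    (u : 'rV[C]_m) :
  injective f -> sqnorm (colsub f u) <= sqnorm u.
Proof.
move=> f_inj; rewrite sqnorm_colsub // [leRHS](bigID (mem (codom f))) /=.
by rewrite lerDl sumr_ge0 // => j _; rewrite exprn_ge0.
Qed.

(** [u *m rowsub f 1%:M] spreads the entries of u to the positions in the image
    of f and fills the other positions with zeros. *)
Lemma colsub_rowsub1K (C : numClosedFieldType) p m (f : 'I_p -> 'I_m)
    (u : 'rV[C]_m) : injective f ->
  (forall j, j \notin codom f -> u 0 j = 0) ->
  colsub f u *m rowsub f 1%:M = u.
Proof.
move=> f_inj u0; apply/rowP => j; rewrite mxE.
under eq_bigr => i _ do rewrite !mxE.
have [/codomP[i ->]|jNf] := boolP (j \in codom f).
  rewrite (bigD1 i) //= eqxx mulr1 big1 ?addr0 // => k ki.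
  by rewrite (inj_eq f_inj) (negPf ki) mulr0.
rewrite u0 // big1 // => i _; case: eqP => [fij|_]; last by rewrite mulr0.
by rewrite -fij codom_f in jNf.
Qed.

(** * Eigenvalues of the Gram matrix and stretched subspaces *)

Section Spectral.
Context {C : numClosedFieldType} {m n : nat} (M : 'M[C]_(m, n)).
Local Notation H := (M^t* *m M).
Local Notation P := (spectralmx H).
Local Notation d := (spectral_diag H).

(** In the coordinates z given by the orthonormal eigenbasis (the rows of P), the
    quadratic form |u M^*|^2 = u (M^* M) u^* is diagonal. *)
Lemma gram_sqnorm (z : 'rV[C]_n) :
  sqnorm (z *m P *m M^t*) = \sum_j d 0 j * `|z 0 j| ^+ 2.
Proof.
have /orthomx_spectralP Hdec : H \is normalmx.
  by apply/normalmxP; rewrite trmx_mul map_mxM trmxCK.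
have := spectral_unitarymx H; move: Hdec.
set Q := P; set e := d => Hdec Qu.
rewrite sqnormE 2!trmx_mul 2!map_mxM trmxCK !mulmxA -(mulmxA _ _ M).
rewrite Hdec !mulmxA mulmxK ?unitarymx_unit // mulmxtVK // mul_mx_diag.
by rewrite mxE; apply: eq_bigr => j _; rewrite !mxE normCK mulrAC mulrC mulrA.
Qed.

Lemma gram_eigenvalue_ge0 j : 0 <= d 0 j.
Proof.
have := gram_sqnorm (delta_mx 0 j).
rewrite (bigD1 j) //= mxE !eqxx normr1 expr1n mulr1 big1 ?addr0 => [<-|k kj].
  by apply: sumr_ge0 => i _; rewrite exprn_ge0.
by rewrite mxE (negPf kj) andbF normr0 expr0n mulr0.
Qed.

Definition eigenspan (S : {pred 'I_n}) : 'M[C]_(#|S|, n) := rowsub enum_val P.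

Lemma rank_eigenspan S : \rank (eigenspan S) = #|S|.
Proof.
apply: mxrank_unitary; apply: rowsub_unitarymx; first exact: enum_val_inj.
exact: spectral_unitarymx.
Qed.

Lemma eigenspanP S (u : 'rV[C]_n) : (u <= eigenspan S)%MS ->
  exists2 z, u = z *m P & forall j, j \notin S -> z 0 j = 0.
Proof.
case/submxP=> y ->; exists (y *m rowsub enum_val 1%:M).
  by rewrite -mulmxA mul_rowsub_mx mul1mx.
move=> j jS; rewrite mxE big1 // => i _; rewrite !mxE.
case: eqP => [eij|_]; last by rewrite mulr0.
by rewrite -eij enum_valP in jS.
Qed.

Definition eigencount (t : C) : nat := #|[pred j | t <= d 0 j]|.

(** Vectors are rows, so M acts through its adjoint.  The factor t bounds the
    squared norm: it is compared with the eigenvalues of M^* M, the squares of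
    the singular values. *)
Definition stretches (t : C) (U : 'M[C]_n) : Prop :=
  forall u : 'rV[C]_n, (u <= U)%MS -> t * sqnorm u <= sqnorm (u *m M^t*).

(** The eigenvectors whose eigenvalues are at least t span such a space. *)
Lemma stretched_subspace t :
  exists2 U, \rank U = eigencount t & stretches t U.
Proof.
pose S := [pred j | (t <= d 0 j)%R]; exists <<eigenspan S>>%MS.
  by rewrite mxrank_gen rank_eigenspan.
move=> u; rewrite genmxE => /eigenspanP[z -> z0].
rewrite gram_sqnorm sqnorm_unitary ?spectral_unitarymx // mulr_sumr.
apply: ler_sum => j _; have [tj|/z0->] := boolP (j \in S).
  by rewrite ler_wpM2r ?exprn_ge0.
by rewrite normr0 expr0n !mulr0.
Qed.

(** If the dimension of U exceeded the number of eigenvalues >= t, then U would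
    meet the span of the other eigenvectors in a nonzero vector, and the
    quadratic form is strictly below t |u|^2 there. *)
Lemma rank_stretched t U : t \is Num.real -> stretches t U ->
  (\rank U <= eigencount t)%N.
Proof.
rewrite /eigencount => t_real tU; rewrite leqNgt; apply/negP => ltU.
pose S := [predC [pred j | (t <= d 0 j)%R]].
(* The dimensions of U and of the span of S add up to more than n. *)
have : (U :&: eigenspan S)%MS != 0.
  apply: contraTneq ltU => UW0; rewrite -leqNgt.
  have := rank_leq_col (U + eigenspan S)%MS.
  rewrite mxrank_disjoint_sum // rank_eigenspan.
  have /esym := cardC [pred j | (t <= d 0 j)%R]; rewrite card_ord => nE.
  move=> rUS; rewrite -(leq_add2r #|S|); apply: leq_trans rUS _.
  exact: eq_leq nE.
rewrite -nz_row_eq0; set u := nz_row _ => u_nz.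
have: (u <= U :&: eigenspan S)%MS by exact: nz_row_sub.
rewrite sub_capmx => /andP[/tU + /eigenspanP[z uE z0]].
rewrite {}uE in u_nz *.
rewrite gram_sqnorm sqnorm_unitary ?spectral_unitarymx // mulr_sumr.
have [j zj] : exists j, z 0 j != 0.
  apply/existsP; rewrite -negb_forall; apply: contraNN u_nz => /forallP z00.
  suff -> : z = 0 by rewrite mul0mx.
  by apply/rowP => j; rewrite mxE; apply/eqP.
have d_lt k : k \in S -> d 0 k < t.
  by rewrite !inE real_ltNge ?(ger0_real (gram_eigenvalue_ge0 k)).
have sum_real (c : 'I_n -> C) : (forall k, c k \is Num.real) ->
    \sum_k c k * `|z 0 k| ^+ 2 \is Num.real.
  by move=> c_real; apply: rpred_sum => k _; rewrite realM ?realX ?normr_real.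
(* The term of index j, where z is nonzero, makes the inequality strict. *)
apply/negP; rewrite -real_ltNge ?sum_real // => [|k]; last first.
  by rewrite ger0_real ?gram_eigenvalue_ge0.
rewrite (bigD1 j) //= [X in _ < X](bigD1 j) //= ltr_leD //.
  rewrite ltr_pM2r ?exprn_gt0 ?normr_gt0 // d_lt //.
  by apply: contraNT zj => /z0->.
apply: ler_sum => k _; have [/d_lt tk|/z0->] := boolP (k \in S).
  by rewrite ler_wpM2r ?exprn_ge0 // ltW.
by rewrite normr0 expr0n !mulr0.
Qed.
End Spectral.

(** * Transfer between a matrix and a submatrix *)

Section Submatrix.
Context {C : numClosedFieldType} {m n p q : nat} (M : 'M[C]_(m, n)).
Context (f : 'I_p -> 'I_m) (g : 'I_q -> 'I_n).
Hypotheses (f_inj : injective f) (g_inj : injective g).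

Local Notation emb := (rowsub g 1%:M : 'M[C]_(q, n)).

Lemma rowsub1_unitarymx : emb \is unitarymx.
Proof. exact/rowsub_unitarymx/unitarymx1. Qed.

Lemma rowsub1_free : row_free emb.
Proof. by rewrite -row_leq_rank mxrank_unitary // rowsub1_unitarymx. Qed.

Lemma mulmx_adj_mxsub (u : 'rV[C]_q) :
  u *m (mxsub f g M)^t* = colsub f (u *m emb *m M^t*).
Proof.
rewrite -mulmxA mul_rowsub_mx mul1mx -mulmx_colsub; congr (_ *m _).
by apply/matrixP => i j; rewrite !mxE.
Qed.

(** A space stretched by the submatrix stays stretched by M after padding with
    zeros: norms are kept, and M^* has more output coordinates. *)
Lemma eigencount_mxsub_le (t : C) : t \is Num.real ->
  (eigencount (mxsub f g M) t <= eigencount M t)%N.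
Proof.
move=> t_real; have [U <- tU] := stretched_subspace (mxsub f g M) t.
rewrite -(mxrankMfree U rowsub1_free) -(mxrank_gen (U *m emb)).
apply: rank_stretched => // u; rewrite genmxE => /submxP[y ->].
rewrite mulmxA (sqnorm_unitary _ _ _ emb) ?rowsub1_unitarymx //.
apply: (le_trans (tU _ (submxMl y U))).
by rewrite mulmx_adj_mxsub sqnorm_colsub_le.
Qed.

(** A space stretched by M loses at most (m - p) + (n - q) dimensions when its
    vectors are required to vanish on the columns outside the image of g, and
    their images under M^* on the rows outside the image of f.  On what remains,
    the submatrix acts with the same norms as M. *)
Lemma eigencount_le_mxsub (t : C) : t \is Num.real ->
  (eigencount M t <= eigencount (mxsub f g M) t + ((m - p) + (n - q)))%N.
Proof.
move=> t_real; have [U <- tU] := stretched_subspace M t.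
pose cf (i : 'I_#|[predC codom f]|) := enum_val i.
pose cg (i : 'I_#|[predC codom g]|) := enum_val i.
(* The left kernel of K consists of the vectors satisfying both requirements. *)
pose K := row_mx (colsub cf (M^t*)) (colsub cg 1%:M).
have rankK : (\rank (U *m K) <= (m - p) + (n - q))%N.
  apply: leq_trans (rank_leq_col _) _.
  by rewrite !card_predC_codom.
rewrite -(mxrank_mul_ker U K) addnC leq_add //; set W := (U :&: kermx K)%MS.
have W_supp (u : 'rV[C]_n) : (u <= W)%MS ->
    colsub g u *m emb = u /\
    sqnorm (colsub f (u *m M^t*)) = sqnorm (u *m M^t*).
  rewrite sub_capmx => /andP[_ /sub_kermxP]; rewrite mul_mx_row.
  rewrite -(row_mx0 _ _ _ _) => /eq_row_mx[uf ug]; split.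
    apply: colsub_rowsub1K => // j jNg.
    have jN : j \in [predC codom g] by [].
    have /rowP/(_ (enum_rank_in jN j)) := ug.
    by rewrite mulmx_colsub mulmx1 !mxE /cg enum_rankK_in.
  rewrite sqnorm_colsub // [RHS](bigID (mem (codom f))) /=.
  rewrite [X in _ + X]big1 ?addr0 //.
  move=> i iNf; have iN : i \in [predC codom f] by [].
  have /rowP/(_ (enum_rank_in iN i)) := uf.
  by rewrite mulmx_colsub !mxE /cf enum_rankK_in // => ->; rewrite normr0 expr0n.
rewrite -(_ : \rank (colsub g W) = \rank W); last first.
  rewrite -(mxrankMfree _ rowsub1_free); congr (\rank _).
  apply/row_matrixP => i; have [<- _] := W_supp _ (row_sub i W).
  rewrite row_mul; congr (_ *m _).
  by apply/rowP=> j; rewrite !mxE.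
rewrite -mxrank_gen; apply: rank_stretched => // v.
rewrite genmxE => /submxP[y ->]; rewrite mulmx_colsub.
have yW := submxMl y W; have [yWE yWM] := W_supp _ yW.
rewrite mulmx_adj_mxsub yWE yWM -(sqnorm_unitary _ _ _ emb) ?rowsub1_unitarymx //.
by rewrite yWE tU // (submx_trans yW) // capmxSl.
Qed.
End Submatrix.

(** * Interlacing of singular values *)

(** Counting turns statements about the position of a value in a sorted list into
    statements about the unsorted list. *)
Lemma le_nth_sort_ge (R : realDomainType) (s : seq R) (i : nat) (t : R) :
  (i < size s)%N ->
  (t <= (sort >=%R s)`_i) = (i < count (fun x => t <= x)%R s)%N.
Proof.
rewrite -(size_sort >=%R s) -(count_sort >=%R).
have : sorted >=%R (sort >=%R s) by apply: sort_sorted => x y; exact: le_total.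
elim: (sort _ s) i => [|x s' IHs] // i /[dup] xs' /path_sorted /IHs {}IHs.
have [tx|xt] := leP t x; first by case: i => [|i] //= i_lt; rewrite tx ?IHs.
have s'_lt : all (< t) s'.
  apply: sub_all (order_path_min ge_trans xs') => y yx; exact: le_lt_trans xt.
have /eqP s'0 : count (fun x => t <= x)%R s' == 0%N.
  rewrite eqn0Ngt -has_count -all_predC; apply: sub_all s'_lt => y /= yt.
  by rewrite -ltNge.
rewrite /= [t <= x]leNgt xt s'0.
case: i => [|i] /= i_lt; first by rewrite leNgt xt.
by rewrite leNgt; have /= -> := allP s'_lt _ (mem_nth 0 i_lt).
Qed.

(** The bound i < n matters: beyond it the default value 0 of [nth] would satisfy
    the left-hand side for t = 0, whereas there are only n eigenvalues. *)
Lemma le_singular_value (R : realType) m n (M : 'M[R[i]]_(m, n)) (i : nat)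
    (t : R) : (i < n)%N -> 0 <= t ->
  (t <= singular_value M i) = (i < eigencount M (t ^+ 2)%:C)%N.
Proof.
move=> i_n t0; rewrite /singular_value le_nth_sort_ge; last first.
  by rewrite size_map size_enum_ord.
rewrite count_map enumT /eigencount cardE /enum_mem size_filter.
congr (_ < _)%N; apply: eq_count => j /=.
rewrite inE -[X in _ = (_ <= X)]RRe_real ?ger0_real ?gram_eigenvalue_ge0 //.
rewrite lecR -[in LHS](ger0_norm t0) -sqrtr_sqr ler_sqrt //.
by rewrite -ler0c RRe_real ?ger0_real ?gram_eigenvalue_ge0.
Qed.

Lemma singular_value_ge0 (R : realType) m n (M : 'M[R[i]]_(m, n)) (i : nat) :
  0 <= singular_value M i.
Proof.
have [i_n|n_i] := ltnP i n; last first.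
  by rewrite /singular_value nth_default // size_sort size_map size_enum_ord.
have : singular_value M i \in singular_values M.
  by rewrite mem_nth // size_sort size_map size_enum_ord.
by rewrite mem_sort => /mapP[j _ ->]; exact: sqrtr_ge0.
Qed.

(** The singular value of the submatrix is itself used as the threshold t. *)
Lemma singular_value_mxsub_le (R : realType) m n p q (M : 'M[R[i]]_(m, n))
    (f : 'I_p -> 'I_m) (g : 'I_q -> 'I_n) (j : nat) :
  injective f -> injective g -> (j < q)%N ->
  singular_value (mxsub f g M) j <= singular_value M j.
Proof.
move=> f_inj g_inj jq.
have := leq_card _ g_inj; rewrite !card_ord => /(leq_trans jq) jn.
rewrite le_singular_value ?singular_value_ge0 //.
apply: leq_trans (eigencount_mxsub_le M f g f_inj g_inj _ _); last first.
  by apply/complex_realP; eexists.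
by rewrite -le_singular_value ?singular_value_ge0.
Qed.

(** Here the threshold is the singular value of M.  The hypothesis says that its
    index j + (m - p) + (n - q) is less than n. *)
Lemma singular_value_le_mxsub (R : realType) m n p q (M : 'M[R[i]]_(m, n))
    (f : 'I_p -> 'I_m) (g : 'I_q -> 'I_n) (j : nat) :
  injective f -> injective g -> (j + (m - p) < q)%N ->
  singular_value M (j + (m - p) + (n - q)) <= singular_value (mxsub f g M) j.
Proof.
move=> f_inj g_inj jq.
have := leq_card _ g_inj; rewrite !card_ord => qn.
rewrite le_singular_value ?singular_value_ge0 //; last first.
  by apply: leq_ltn_trans jq; rewrite leq_addr.
rewrite -(ltn_add2r ((m - p) + (n - q))).
apply: leq_trans (eigencount_le_mxsub M f g f_inj g_inj _ _); last first.
  by apply/complex_realP; eexists.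
rewrite addnA -le_singular_value ?singular_value_ge0 //.
by rewrite addnC -ltn_subRL subKn.
Qed.

(** * Tensors *)

Lemma dft_subtensor (R : realType) m n p q r (A : tensor R m n r)
    (B : tensor R p q r) (f : 'I_p -> 'I_m) (g : 'I_q -> 'I_n) :
  (forall k, B k = mxsub f g (A k)) ->
  forall k, dft B k = mxsub f g (dft A k).
Proof.
move=> BA k; apply/matrixP => i j; rewrite mxE !summxE.
by apply: eq_bigr => l _; rewrite BA !mxE.
Qed.

Theorem theorem3p1 (R : realType) (m n p q r : nat)
    (m_gt0 : (0 < m)%N) (n_gt0 : (0 < n)%N) (p_gt0 : (0 < p)%N)
    (q_gt0 : (0 < q)%N) (r_gt0 : (0 < r)%N)
    (le_pm : (p <= m)%N) (le_qn : (q <= n)%N)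
    (A : tensor R m n r) (B : tensor R p q r) (subBA : subtensor B A) :
  (forall j : nat, (j < minn p q)%N ->
     tensor_singular_value B j <= tensor_singular_value A j) /\
  (forall j : nat, (j < minn (p + q - m) (p + q - n))%N ->
     tensor_singular_value A (j + (m - p) + (n - q)) <=
     tensor_singular_value B j).
Proof.
have incr_inj a b (h : 'I_a -> 'I_b) :
    {homo h : i j / (i < j)%N} -> injective h.
  move=> h_incr i j hij; apply/val_inj; case: (ltngtP i j) => // /h_incr;
  by rewrite hij ltnn.
case: subBA => f [g [/incr_inj f_inj /incr_inj g_inj /dft_subtensor dftB]].
split=> j; rewrite leq_min => /andP[j1 j2].
  rewrite ler_wpM2l ?invr_ge0 ?ler0n // ler_sum // => k _.
  by rewrite dftB singular_value_mxsub_le.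
rewrite ler_wpM2l ?invr_ge0 ?ler0n // ler_sum // => k _.
rewrite dftB singular_value_le_mxsub //.
by rewrite addnC -ltn_subRL subnBA // addnC.
Qed.
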